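(* Let $N\ge1$, $L,R>0$, $\gamma\ge0$, $\sigma=\gamma/L$. Let $u(\sigma)\ge1$ be defined implicitly as the solution $u\geq 1$ of $\sigma^2=u^2-1-2\log u$, let $$\xi_N(\sigma)=\sqrt{\frac{\sigma^2+2\log u(\sigma)}{\sigma^2+H_{N+1}\left(1+\frac{N+1}{u(\sigma)^2-1}\right)}},$$ and set, for $k=0,\dots,N-1$, $$\alpha_k'=\frac RL\cdot\frac{N-k}{(N+1)^{3/2}}\cdot\frac{u(\sigma)}{u(\sigma)^2-(u(\sigma)^2-1)\frac k{N+1}}\cdot\xi_N(\sigma).$$ Then any subgradient method with step size schedule $h\in\mathcal H(\alpha')$ satisfies $$f(x_{N+1})-f_\star\le\frac{RL}{\sqrt{N+1}}\cdot u(\sigma)$$ for every $f\in\mathcal F$, every choice of subgradients $g_k\in\partial f(x_k)$ and all errors with $\sum_{k=0}^{N-1}\|e_k\|^2\le\gamma^2$. Furthermore, $1\le\xi_N(\sigma)\le1+\frac2N$ for any $\sigma\in[0,\sqrt N]$.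
   Context: $H_m(a)=\sum_{k=0}^{m-1}\frac1{a+k}$ denotes the generalized harmonic numbers. At $\sigma=0$ (where $u(0)=1$ and the formula for $\xi_N$ reads $0/0$) set $\xi_N(0):=1$, its limit as $\sigma\downarrow0$. Setting. $X$ is a real Hilbert space, $x_0\in X$. $\mathcal F$ is the class of convex $f:X\to\mathbb R$ all of whose subgradients (at all points) have norm at most $L$ and which attain their minimum $f_\star=f(x_\star)$ at some $x_\star$ with $\|x_\star-x_0\|\le R$. Method. A step size schedule is $h=(h_0,\dots,h_N)$ with $h_0,\dots,h_{N-1}\in[0,\infty)$, $h_N\in[0,\infty]$ and $\sum_i h_i>0$. The method is $x_{k+1}=x_k-h_k\tilde g_k$ with $\tilde g_k=g_k+e_k$, $g_k\in\partial f(x_k)$ for $k=0,\dots,N-1$, and $x_{N+1}=\sum_{k=0}^Nh_kx_k/\sum_{k=0}^Nh_k$. If $h_N=\infty$, then $x_{N+1}=x_N$, and for $k<N$ one reads $\sum_{i=k+1}^Nh_i/\sum_{i=0}^Nh_i=1$. Admissibility. $\mathcal H$ is the set of schedules $h$ for which $\frac{1}{N-k}\sum_{j=k+1}^Nh_j$ is nondecreasing in $k\in\{0,\dots,N-1\}$ (always true if $h_N=\infty$). For $\alpha\in\mathbb R^N_{\ge 0}$, $\mathcal H(\alpha)$ is the set of $h\in\mathcal H$ with $h_k\cdot\frac{\sum_{i=k+1}^Nh_i}{\sum_{i=0}^Nh_i}=\alpha_k$ for all $k=0,\dots,N-1$.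
   Formalization: The functions f in the class are also assumed continuous (automatic in finite dimension); without it the claim fails in infinite dimension, e.g. for f=|φ| with φ a discontinuous linear form, N=1, h_1=∞, γ>0. *)

(* Defs.v *)
From HB Require Import structures.
From mathcomp Require Import all_boot all_order all_algebra.
From mathcomp Require Import all_classical all_reals all_analysis.

Set Implicit Arguments.
Unset Strict Implicit.
Unset Printing Implicit Defensive.

Import Order.TTheory GRing.Theory Num.Theory.
Import numFieldNormedType.Exports.

Local Open Scope classical_set_scope.
Local Open Scope ring_scope.

Section ConvexClass.
Context {K : realType} {X : completeNormedModType K}.
Variable dot : {dot X for idfun}.

Definition subdifferential (f : X -> K) (x : X) : set X :=
  [set g | forall y, f x + dot g (y - x) <= f y].

Definition is_minimizer (f : X -> K) (xs : X) : Prop :=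
  forall y, f xs <= f y.

(* Continuity is automatic for convex f : X -> K if X has finite dimension. In
   infinite dimension it excludes convex functions such as |phi|, with phi a
   discontinuous linear form: its only subgradients are 0, on the kernel of phi,
   so that a bound on the subgradients gives no control on the function. *)
Definition convex_class (L R : K) (x0 : X) : set (X -> K) :=
  [set f | [/\ convex_function setT f,
               continuous f,
               (forall x g, subdifferential f x g -> `|g| <= L) &
               exists xs, is_minimizer f xs /\ `|xs - x0| <= R]].

End ConvexClass.

(* Step size schedules are sequences h : nat -> \bar K of which only the terms
   h 0, ..., h N are used. *)
Section Schedules.
Context {K : realType}.
Implicit Types (N k : nat) (h : nat -> \bar K) (alpha : nat -> K).

Definition is_schedule N h : Prop :=
  [/\ (forall k, (k < N)%N -> (0 <= h k < +oo)%E),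
      (0 <= h N)%E &
      (0 < \sum_(0 <= i < N.+1) h i)%E].

Definition tail_ratio N h k : K :=
  if h N == +oo%E then 1
  else fine (\sum_(k.+1 <= i < N.+1) h i)%E
       / fine (\sum_(0 <= i < N.+1) h i)%E.

Definition tail_mean N h k : \bar K :=
  (((N - k)%:R^-1)%:E * \sum_(k.+1 <= j < N.+1) h j)%E.

Definition admissible N : set (nat -> \bar K) :=
  [set h | is_schedule N h /\
           forall k l, (k <= l < N)%N -> (tail_mean N h k <= tail_mean N h l)%E].

Definition admissible_for N alpha : set (nat -> \bar K) :=
  [set h | admissible N h /\
           forall k, (k < N)%N -> fine (h k) * tail_ratio N h k = alpha k].

End Schedules.

Section Method.
Context {K : realType} {X : completeNormedModType K}.
Variable dot : {dot X for idfun}.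

Definition final_point (N : nat) (h : nat -> \bar K) (x : nat -> X) : X :=
  if h N == +oo%E then x N
  else (\sum_(0 <= k < N.+1) fine (h k))^-1
       *: \sum_(0 <= k < N.+1) fine (h k) *: x k.

Definition subgradient_method (N : nat) (h : nat -> \bar K) (f : X -> K)
    (x0 : X) (x g e : nat -> X) : Prop :=
  [/\ x 0%N = x0,
      (forall k, (k < N)%N -> subdifferential dot f (x k) (g k)),
      (forall k, (k < N)%N -> x k.+1 = x k - fine (h k) *: (g k + e k)) &
      x N.+1 = final_point N h x].

End Method.

Section Rates.
Context {K : realType}.

Definition gen_harmonic (m : nat) (a : K) : K := \sum_(k < m) (a + k%:R)^-1.

(* For every s the set has exactly one element, so the default 1 is not used. *)
Definition u_sol (s : K) : K :=
  xget 1 [set u | 1 <= u /\ s ^+ 2 = u ^+ 2 - 1 - 2 * ln u].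

Definition xi (N : nat) (s : K) : K :=
  if s == 0 then 1
  else let u := u_sol s in
    Num.sqrt ((s ^+ 2 + 2 * ln u) /
      (s ^+ 2 + gen_harmonic N.+1 (1 + N.+1%:R / (u ^+ 2 - 1)))).

Definition alpha' (N : nat) (L R s : K) (k : nat) : K :=
  let u := u_sol s in
  R / L * ((N - k)%:R / N.+1%:R `^ (3 / 2))
  * (u / (u ^+ 2 - (u ^+ 2 - 1) * (k%:R / N.+1%:R))) * xi N s.

End Rates.

(* Main.v *)
Require Import Defs.
From mathcomp Require Import all_boot all_order all_algebra.
From mathcomp Require Import all_classical all_reals all_analysis.
From mathcomp Require Import ring lra.
Import Order.TTheory GRing.Theory Num.Theory.
Import numFieldNormedType.Exports.
Local Open Scope classical_set_scope.
Local Open Scope ring_scope.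

(** Put n = N + 1, t = u^2 - 1, and rescale the prescribed products alpha' to
    the effective steps
      beta_k = n alpha'_k / (N - k)
             = (R / L) (xi / sqrt n) u / (u^2 - t k / n).
    Follow the auxiliary sequence w_0 = x_0 - xs,
    w_(k+1) = w_k - beta_k (g_k + e_k), and let g_N stand for a subgradient at
    the output point x_(N+1).

    The schedule enters only through the ratios
    r_k = n (h_k + ... + h_N) / ((n - k) (h_0 + ... + h_N)), because
    h_k r_(k+1) = beta_k says that w_(k+1) = w_k + r_(k+1) (x_(k+1) - x_k).
    Hence w_k is the combination of x_k - xs with weight 1 and of the x_k - x_i,
    i < k, with weights r_(i+1) - r_i. Admissibility makes these nonnegative, save
    for r_1 - r_0, where the values of alpha' decide ([first_step_ratio_ge]). At
    the end, the definition of x_(N+1) turns w_N into a nonnegative combination of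
    x_(N+1) - xs and of the x_(N+1) - x_i. Applying the subgradient inequality
    along each of these differences and summing over k, all values f(x_i) with
    i < N cancel, and what remains is [gap_le_regret]:
      n (f(x_(N+1)) - f(xs)) <= sum_(k <= N) <g_k, w_k>.

    The right-hand side is estimated in [regret_bound]. With the tail sums
    S_k = g_k + ... + g_N, completing squares in twice this sum leaves
    (beta_k - beta_(k+1)) |S_(k+1)|^2 at step k, while the error e_k costs at
    most b |e_k|^2 + d beta_k^2 |S_(k+1)|^2 by Young's inequality with b d = 1.
    The terms in S_(k+1) are harmless as soon as
    beta_k + d beta_k^2 <= beta_(k+1), and this holds since 1 / beta_k is affine
    in k with slope - d. What is left is
      (R^2 / beta_0 + L^2 sum_(k <= N) beta_k + b gamma^2) / 2,
    which for sigma > 0 equals R L sqrt n u / xi: the sum of the beta_k is a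
    multiple of H = H_n(1 + n / t), and xi^2 (sigma^2 + H) = sigma^2 + 2 log u = t
    is what makes the three terms add up. As xi >= 1, dividing by n gives the
    rate.

    Finally, H is the right Riemann sum with n intervals of the integral of
    1 / (1 + y) over [0, t], whose value is 2 log u. So
    H <= 2 log u <= H + (t / n) (1 - 1 / (1 + t)), whence
    1 <= xi^2 <= 1 + 1 / N.

    One analytic point: no subgradient is given at x_(N+1). Continuity of f and
    completeness of the space provide, for each eps > 0, an eps-subgradient of
    norm at most L there ([approx_subgradient]), and eps tends to 0 at the end. *)

(** * Inner products and approximate subgradients *)

Section InnerProduct.
Context {K : realType} {X : completeNormedModType K}.
Context {dot : {dot X for idfun}}.

Lemma dotC (u v : X) : dot u v = dot v u.
Proof. by rewrite hermC expr0 mul1r. Qed.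

Lemma dotDl (u v w : X) : dot (u + v) w = dot u w + dot v w.
Proof. exact: linearDl. Qed.

Lemma dotDr (u v w : X) : dot w (u + v) = dot w u + dot w v.
Proof. exact: linearDr. Qed.

Lemma dotNl (u w : X) : dot (- u) w = - dot u w.
Proof. exact: linearNl. Qed.

Lemma dotNr (u w : X) : dot w (- u) = - dot w u.
Proof. exact: linearNr. Qed.

Lemma dotZl a (u w : X) : dot (a *: u) w = a * dot u w.
Proof. exact: linearZl_LR. Qed.

Lemma dotZr a (u w : X) : dot w (a *: u) = a * dot w u.
Proof. exact: linearZr_LR. Qed.

Lemma dot_sumr n (F : nat -> X) (w : X) :
  dot w (\sum_(i < n) F i) = \sum_(i < n) dot w (F i).
Proof. exact: linear_sumr. Qed.

Definition dotE := (dotDl, dotDr, dotNl, dotNr, dotZl, dotZr).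

Hypothesis dot_norm : forall v : X, dot v v = `|v| ^+ 2.

Lemma normB_conv (t : K) (u v : X) :
  `|t *: u + (1 - t) *: v| ^+ 2 =
  t * `|u| ^+ 2 + (1 - t) * `|v| ^+ 2 - t * (1 - t) * `|u - v| ^+ 2.
Proof. rewrite -!dot_norm !dotE (dotC v u). ring. Qed.

Lemma convex_functionP {f : X -> K} {t : K} (x y : X) :
  convex_function setT f -> 0 <= t <= 1 ->
  f (t *: x + (1 - t) *: y) <= t * f x + (1 - t) * f y.
Proof.
move=> cf /andP[t0 t1].
have ti : Itv.spec (@Itv.num_sem K) (Itv.Real `[0%Z, 1%Z]) t.
  by rewrite /Itv.spec /= /Itv.num_sem /= in_itv/= t0 t1 num_real.
exact: (cf (Itv.mk ti) x y (mem_set I) (mem_set I)).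
Qed.

(** The penalized function f + mu |. - x|^2 is strongly convex, so that a
    minimizing sequence is Cauchy; completeness of the space gives its limit. *)
Lemma prox_point_exists {f : X -> K} {m mu : K} (x : X) :
    convex_function setT f -> continuous f -> (forall y, m <= f y) -> 0 < mu ->
  exists p, forall y, f p + mu * `|p - x| ^+ 2 <= f y + mu * `|y - x| ^+ 2.
Proof.
move=> cvxf cf mf mu0; pose phi y := f y + mu * `|y - x| ^+ 2.
(* Strong convexity of the penalized function, at midpoints. *)
have phi_conv y z : mu / 4 * `|y - z| ^+ 2 <=
    phi y / 2 + phi z / 2 - phi (2^-1 *: y + (1 - 2^-1) *: z).
  have h : 0 <= (2^-1 : K) <= 1 by lra.
  have := convex_functionP y z cvxf h.
  have -> : phi (2^-1 *: y + (1 - 2^-1) *: z) =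
      f (2^-1 *: y + (1 - 2^-1) *: z)
      + mu * `|2^-1 *: (y - x) + (1 - 2^-1) *: (z - x)| ^+ 2.
    rewrite /phi; congr (_ + _ * `|_| ^+ 2).
    by rewrite !scalerBr addrACA -opprD -scalerDl subrKC scale1r.
  rewrite normB_conv /phi opprB addrA subrK; lra.
have inf_phi : has_inf [set phi y | y in setT].
  split; first by exists (phi x), x.
  exists m => _ [y _ <-]; rewrite (le_trans (mf y))// lerDl.
  by rewrite mulr_ge0 ?exprn_ge0 // ltW.
set M := inf [set phi y | y in setT].
have M_le y : M <= phi y by apply: (ge_inf inf_phi.2); exists y.
have [s s_lt] : {s : nat -> X & forall n, phi (s n) < M + n.+1%:R^-1}.
  apply: (@choice _ _ (fun n y => phi y < M + n.+1%:R^-1)) => n.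
  have n0 : 0 < n.+1%:R^-1 :> K by rewrite invr_gt0.
  by have [_ [y _ <-] ?] := inf_adherent n0 inf_phi; exists y.
have s_cvg : cvg (s n @[n --> \oo]).
  apply: cauchy_cvg; apply: cauchy_exP => e e0.
  have c0 : 0 < mu / 4 * e ^+ 2 by rewrite mulr_gt0 ?exprn_gt0 ?divr_gt0.
  have [k _ /(_ _ (leqnn k)) kE] := near_infty_natSinv_lt (PosNum c0).
  have {kE} : k.+1%:R^-1 < mu / 4 * e ^+ 2 := kE.
  move=> kE.
  exists (s k); exists k => // n /= kn; rewrite -ball_normE /=.
  have nk : n.+1%:R^-1 <= k.+1%:R^-1 :> K by rewrite lef_pV2 ?posrE ?ler_nat.
  have := phi_conv (s k) (s n); have := s_lt k; have := s_lt n.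
  have := M_le (2^-1 *: s k + (1 - 2^-1) *: s n).
  move: kE nk; move: (phi (_ + _)) (k.+1%:R^-1) (n.+1%:R^-1) => a b c.
  move: (phi (s k)) (phi (s n)) => u v h1 h2 h3 h4 h5 h6.
  have : mu / 4 * `|s k - s n| ^+ 2 < mu / 4 * e ^+ 2 by lra.
  by rewrite ltr_pM2l ?divr_gt0// ltr_pXn2r ?nnegrE// ltW.
exists (lim (s n @[n --> \oo])) => y; apply: le_trans (M_le y).
set p := lim _.
have dist_cvg : `|y - x| @[y --> p] --> `|p - x|.
  by apply: cvg_norm; apply: cvgB; [exact: cvg_id | exact: cvg_cst].
have sq_cvg : `|y - x| * `|y - x| @[y --> p] --> `|p - x| * `|p - x|.
  exact: (cvgM dist_cvg dist_cvg).
have phi_cvg : f y + mu * (`|y - x| * `|y - x|) @[y --> p] --> phi p.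
  exact: (cvgD (cf p) (cvgMl_tmp sq_cvg)).
have phip : (phi \o s) n @[n --> \oo] --> phi p.
  by apply: continuous_cvg; [exact: phi_cvg | exact: s_cvg].
have Mp : M + harmonic n @[n --> \oo] --> M + 0.
  by apply: cvgD; [exact: cvg_cst | exact: cvg_harmonic].
rewrite addr0 in Mp; apply: (ler_cvg_to phip Mp).
by near=> n; exact: ltW (s_lt n).
Unshelve. all: by end_near. Qed.

(** First-order optimality at p in the direction y - p: the quadratic penalty
    contributes its derivative and a term of order t^2, and t tends to 0. *)
Lemma prox_subgradient {f : X -> K} {mu : K} {x p : X} :
    convex_function setT f ->
    (forall y, f p + mu * `|p - x| ^+ 2 <= f y + mu * `|y - x| ^+ 2) ->
  subdifferential dot f p ((2 * mu) *: (x - p)).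
Proof.
move=> cvxf p_min y; rewrite dotZl leNgt; apply/negP => lt.
set A := f p + _ in lt; pose C := `|mu| * `|y - p| ^+ 2.
have C0 : 0 <= C by rewrite mulr_ge0// exprn_ge0.
have D0 : 0 < A - f y + C + 1 by lra.
(* If the subgradient inequality failed at y by A - f y > 0, a step towards y
   with the quadratic term t C below that defect would contradict p_min. *)
pose t := (A - f y) / (A - f y + C + 1).
have t0 : 0 < t by rewrite divr_gt0// subr_gt0.
have t1 : t <= 1 by rewrite ler_pdivrMr//; lra.
have tC : t * C < A - f y by rewrite mulrAC ltr_pdivrMr// ltr_pM2l; lra.
have ti : 0 <= t <= 1 by rewrite (ltW t0).
have := convex_functionP y p cvxf ti.
have := p_min (t *: y + (1 - t) *: p).
have -> : t *: y + (1 - t) *: p - x = t *: (y - p) + (p - x).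
  by rewrite scalerBr scalerBl scale1r -!addrA; congr (_ + _); rewrite addrCA.
have -> : `|t *: (y - p) + (p - x)| ^+ 2 =
    t ^+ 2 * `|y - p| ^+ 2 - 2 * t * dot (x - p) (y - p) + `|p - x| ^+ 2.
  rewrite -!dot_norm !dotE (dotC y x) (dotC p x) (dotC p y); ring.
have : t * (mu * (t * `|y - p| ^+ 2)) <= t * (t * C).
  rewrite ler_pM2l// mulrCA ler_pM2l// ler_wpM2r ?exprn_ge0//.
  exact: ler_norm.
have : t * (t * C) < t * (A - f y) by rewrite ltr_pM2l.
rewrite /A; set d := dot _ _; lra.
Qed.

(** In infinite dimension a norm bound on the subgradients at x is of use
    only once some are exhibited nearby. The proximal points p of x carry exact
    subgradients, which are multiples of x - p, so that the bound L forces p to x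
    as the penalty grows. *)
Lemma approx_subgradient {f : X -> K} {L m : K} (x : X) {eps : K} :
    convex_function setT f -> continuous f -> (forall y, m <= f y) -> 0 < L ->
    (forall y g, subdifferential dot f y g -> `|g| <= L) -> 0 < eps ->
  exists2 g, `|g| <= L & forall y, f x + dot g (y - x) <= f y + eps.
Proof.
move=> cvxf cf mf L0 fL e0.
have /cvgrPdist_lt/(_ _ e0)/nbhs_ballP[d /= d0 dB] := cf x.
have mu0 : 0 < L / d by rewrite divr_gt0.
have [p p_min] := prox_point_exists x cvxf cf mf mu0.
have gp := prox_subgradient cvxf p_min.
exists ((2 * (L / d)) *: (x - p)); first exact: fL gp.
have xp : `|x - p| < d.
  have := fL _ _ gp; rewrite normrZ gtr0_norm ?(mulr_gt0 _ mu0)//.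
  have -> : 2 * (L / d) * `|x - p| = L * (2 * `|x - p| / d) by ring.
  rewrite ger_pMr// ler_pdivrMr// mul1r; have := normr_ge0 (x - p); lra.
move=> y; have := gp y.
have /dB : ball x d p by rewrite -ball_normE.
move=> /= /ltr_normlP[_ fxp].
have -> : y - p = (y - x) + (x - p) by rewrite addrA subrK.
(* Moving the base point from p to x lowers the bound: <g, x - p> is the
   nonnegative number 2 mu |x - p|^2. *)
rewrite dotDr (dotZl _ (x - p) (x - p)) dot_norm.
have : 0 <= 2 * (L / d) * `|x - p| ^+ 2.
  by rewrite mulr_ge0 ?exprn_ge0// mulr_ge0// ltW.
lra.
Qed.

End InnerProduct.

(** * Regret of the perturbed linear recurrence *)

Lemma sum_ord_recl {V : nmodType} (F : nat -> V) (n : nat) :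
  \sum_(k < n.+1) F k = F 0%N + \sum_(k < n) F k.+1.
Proof. by rewrite big_ord_recl. Qed.

Section Regret.
Context {K : realType} {X : completeNormedModType K}.
Context {dot : {dot X for idfun}}.
Hypothesis dot_norm : forall v : X, dot v v = `|v| ^+ 2.

(** Induction on N, peeling off the first step. With S' the sum of the later g_k,
      - 2 beta_0 <g_0, S'> = beta_0 (|g_0|^2 + |S'|^2 - |g_0 + S'|^2),
    and the growth of beta leaves room for the part d beta_0^2 |S'|^2 of the
    cost of the error e_0. The hypothesis on e is kept in the form of Young's
    inequality so as to cover at once b d = 1 and the case b = d = 0, e = 0. *)
Lemma regret_bound {N : nat} {g e w : nat -> X} {beta : nat -> K} {L b d : K} :
    (forall k, (k <= N)%N -> `|g k| <= L) ->
    (forall k, (k < N)%N -> w k.+1 = w k - beta k *: (g k + e k)) ->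
    (forall k, (k <= N)%N -> 0 <= beta k) ->
    (forall k, (k < N)%N -> beta k + d * beta k ^+ 2 <= beta k.+1) ->
    (forall k v, (k < N)%N ->
       - 2 * dot (e k) v <= b * `|e k| ^+ 2 + d * `|v| ^+ 2) ->
  let S := \sum_(k < N.+1) g k in
  2 * \sum_(k < N.+1) dot (g k) (w k) <=
  2 * dot S (w 0%N) - beta 0%N * `|S| ^+ 2
  + L ^+ 2 * \sum_(k < N.+1) beta k + b * \sum_(k < N) `|e k| ^+ 2.
Proof.
have sq0 (v : X) : 0 <= `|v| ^+ 2 by rewrite exprn_ge0.
elim: N g e w beta => [|N IH] g e w beta gL wS beta0 betaS young /=.
  rewrite !big_ord1 big_ord0 /= mulr0 addr0.
  have : beta 0%N * `|g 0%N| ^+ 2 <= beta 0%N * L ^+ 2.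
    by rewrite ler_wpM2l ?beta0 // ler_pXn2r ?nnegrE ?(le_trans _ (gL 0%N _)) ?gL.
  lra.
have {IH} := IH (g \o S) (e \o S) (w \o S) (beta \o S)
  (fun k => gL k.+1) (fun k => wS k.+1) (fun k => beta0 k.+1)
  (fun k => betaS k.+1) (fun k v => young k.+1 v).
rewrite /= (sum_ord_recl g) (sum_ord_recl (fun k => dot (g k) (w k))).
rewrite (sum_ord_recl beta) (sum_ord_recl (fun k => `|e k| ^+ 2)).
set S := \sum_(k < N.+1) g k.+1; set D := \sum_(k < N.+1) dot _ _.
set B := \sum_(k < N.+1) beta k.+1; set E := \sum_(k < N) `|e k.+1| ^+ 2.
rewrite (wS 0%N)// -!dot_norm !dotE !dot_norm (dotC S (g 0%N)) (dotC S (e 0%N)).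
have h1 := young 0%N (beta 0%N *: S) isT.
have h2 : beta 0%N * `|g 0%N| ^+ 2 <= beta 0%N * L ^+ 2.
  by rewrite ler_wpM2l ?beta0 // ler_pXn2r ?nnegrE ?(le_trans _ (gL 0%N _)) ?gL.
have h3 := ler_wpM2r (sq0 S) (betaS 0%N isT).
rewrite dotZr -[`|_ *: S| ^+ 2]dot_norm !dotE dot_norm in h1.
lra.
Qed.

Lemma regret_bound_radius {N : nat} {g e w : nat -> X} {beta : nat -> K}
    {L R b d : K} :
    (forall k, (k <= N)%N -> `|g k| <= L) ->
    (forall k, (k < N)%N -> w k.+1 = w k - beta k *: (g k + e k)) ->
    (forall k, (k <= N)%N -> 0 < beta k) ->
    (forall k, (k < N)%N -> beta k + d * beta k ^+ 2 <= beta k.+1) ->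
    (forall k v, (k < N)%N ->
       - 2 * dot (e k) v <= b * `|e k| ^+ 2 + d * `|v| ^+ 2) ->
    `|w 0%N| <= R ->
  2 * \sum_(k < N.+1) dot (g k) (w k) <=
  R ^+ 2 / beta 0%N
  + L ^+ 2 * \sum_(k < N.+1) beta k + b * \sum_(k < N) `|e k| ^+ 2.
Proof.
move=> gL wS beta0 betaS young w0R.
have := regret_bound gL wS (fun k kN => ltW (beta0 k kN)) betaS young.
move=> /= /le_trans; apply; rewrite lerD2r lerD2r.
set S := \sum_(k < N.+1) g k.
have : 0 <= dot (w 0%N - beta 0%N *: S) (w 0%N - beta 0%N *: S).
  by rewrite dot_norm exprn_ge0.
have : `|w 0%N| ^+ 2 <= R ^+ 2.
  by rewrite ler_pXn2r ?nnegrE// (le_trans _ w0R).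
rewrite ler_pdivlMr ?beta0// !dotE !dot_norm (dotC (w 0%N)); lra.
Qed.

End Regret.

(** * From the regret to the gap at the output point *)

Section LastIterate.
Context {K : realType}.
Implicit Types (A r : nat -> K) (N : nat).

(** The weight of the comparison of the output point with x_i. Taken at N + 1 it
    is the coefficient of x_i in (N + 1) x_(N+1) when r comes from a schedule. *)
Definition pair_weight N r (i : nat) : K :=
  (N%:R - i%:R) * r i - (N%:R - i%:R - 1) * r i.+1.

Lemma sum_pair_weight N r : r 0%N = 1 ->
  \sum_(i < N) pair_weight N r i = N%:R.
Proof.
move=> r0.
have E M : (M <= N)%N ->
    \sum_(i < M) pair_weight N r i = N%:R * r 0%N - (N%:R - M%:R) * r M.
  elim: M => [|M IH] MN; first by rewrite big_ord0 subr0 subrr.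
  rewrite big_ord_recr /= IH 1?ltnW// /pair_weight -natr1; ring.
by rewrite E// subrr mul0r subr0 r0 mulr1.
Qed.

(** The scalars A k stand for <g, x_k> with a fixed g, which reduces the
    identities between vectors of this section to identities between scalars. *)
Lemma combination_recurrence {N r A} {a : K} {W : nat -> K} :
    r 0%N = 1 -> W 0%N = A 0%N - a ->
    (forall k, (k < N)%N -> W k.+1 = W k + r k.+1 * (A k.+1 - A k)) ->
  forall k, (k <= N)%N ->
    W k = \sum_(i < k) (r i.+1 - r i) * (A k - A i) + (A k - a).
Proof.
move=> r0 W0 WS; elim=> [|k IH] kN; first by rewrite big_ord0 add0r.
rewrite WS// IH 1?ltnW// big_ord_recr /=.
have -> : \sum_(i < k) (r i.+1 - r i) * (A k.+1 - A i) =
    \sum_(i < k) (r i.+1 - r i) * (A k - A i) + (r k - r 0%N) * (A k.+1 - A k).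
  have -> : r k - r 0%N = \sum_(i < k) (r i.+1 - r i).
    by rewrite -(big_mkord predT (fun i => r i.+1 - r i)) telescope_sumr.
  rewrite mulr_suml -big_split /=; apply: eq_bigr => i _; ring.
rewrite r0; ring.
Qed.

Lemma pair_weight_succ N r i :
  pair_weight N.+1 r i = pair_weight N r i - (r i.+1 - r i).
Proof. rewrite /pair_weight -natr1; ring. Qed.

Lemma sum_increment_gaps N r A : r 0%N = 1 ->
  \sum_(i < N) (r i.+1 - r i) * (A N - A i) =
  (r N - 1) * A N - \sum_(i < N) (r i.+1 - r i) * A i.
Proof.
move=> r0; have -> : r N - 1 = \sum_(i < N) (r i.+1 - r i).
  by rewrite -(big_mkord predT (fun i => r i.+1 - r i)) telescope_sumr// r0.
by rewrite mulr_suml -sumrB; apply: eq_bigr => i _; rewrite mulrBr.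
Qed.

Lemma sum_pair_weight_succ N r A :
  \sum_(i < N) pair_weight N.+1 r i * A i =
  \sum_(i < N) pair_weight N r i * A i - \sum_(i < N) (r i.+1 - r i) * A i.
Proof.
by rewrite -sumrB; apply: eq_bigr => i _; rewrite pair_weight_succ mulrBl.
Qed.

Lemma sum_pair_weight_gaps N r A (a : K) : r 0%N = 1 ->
  \sum_(i < N) pair_weight N r i * (a - A i) =
  N%:R * a - \sum_(i < N) pair_weight N r i * A i.
Proof.
move=> r0; rewrite -(sum_pair_weight N r r0) mulr_suml -sumrB.
by apply: eq_bigr => i _; rewrite mulrBr.
Qed.

Lemma combination_last {N r A} {a xb W : K} :
    r 0%N = 1 ->
    W = \sum_(i < N) (r i.+1 - r i) * (A N - A i) + (A N - a) ->
    N.+1%:R * xb = \sum_(i < N) (pair_weight N.+1 r i) * A i + r N * A N ->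
  W = \sum_(i < N) pair_weight N r i * (xb - A i) + (xb - a).
Proof.
move=> r0 -> xbE; rewrite sum_pair_weight_gaps// sum_increment_gaps//.
move: xbE; rewrite sum_pair_weight_succ -natr1; lra.
Qed.

(** The cancellation behind the last-iterate analysis: the values collected at
    the points x_k with k < N are exactly those that the comparisons of the
    output point with the x_i give back. *)
Lemma sum_pair_gaps N r A : r 0%N = 1 ->
  \sum_(k < N) (\sum_(i < k) (r i.+1 - r i) * (A k - A i) + A k) =
  \sum_(i < N) pair_weight N r i * A i.
Proof.
move=> r0; elim: N => [|N IH]; first by rewrite !big_ord0.
rewrite !big_ord_recr /= IH sum_increment_gaps// sum_pair_weight_succ.
rewrite /pair_weight -natr1; ring.
Qed.

(** With m = N - i, the weight at N multiplied by m + 1 is r_(i+1) plus m times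
    the weight at N + 1. *)
Lemma pair_weight_ge0 N r i : (i < N)%N -> 0 <= r i.+1 ->
  0 <= pair_weight N.+1 r i -> 0 <= pair_weight N r i.
Proof.
move=> iN ri; rewrite /pair_weight -natr1 => c0.
have m1 : 1 <= N%:R - i%:R :> K by rewrite -natrB 1?ltnW// ler1n subn_gt0.
have : 0 <= (N%:R - i%:R) * ((N%:R + 1 - i%:R) * r i
   - (N%:R + 1 - i%:R - 1) * r i.+1) by rewrite mulr_ge0//; lra.
move=> {c0} c0.
rewrite -(pmulr_rge0 _ (_ : 0 < N%:R - i%:R + 1)); last by lra.
nra.
Qed.

End LastIterate.

Section GapBound.
Context {K : realType} {X : completeNormedModType K}.
Context {dot : {dot X for idfun}}.

(** Monotonicity of r is required below N only: r_N does not occur as an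
    increment in w_k for k < N, and w_N is rewritten through the output point. *)
Lemma gap_le_regret {N : nat} {f : X -> K} {xs xb : X} {x g w : nat -> X}
    {r : nat -> K} {eps : K} :
    r 0%N = 1 -> (forall i, (i.+1 < N)%N -> r i <= r i.+1) ->
    (forall i, (i < N)%N -> 0 <= r i.+1) ->
    (forall i, (i < N)%N -> 0 <= pair_weight N.+1 r i) ->
    (forall k, (k < N)%N -> subdifferential dot f (x k) (g k)) ->
    (forall y, f xb + dot (g N) (y - xb) <= f y + eps) ->
    w 0%N = x 0%N - xs ->
    (forall k, (k < N)%N -> w k.+1 = w k + r k.+1 *: (x k.+1 - x k)) ->
    N.+1%:R *: xb = \sum_(i < N) pair_weight N.+1 r i *: x i + r N *: x N ->
  N.+1%:R * (f xb - f xs) <=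
  \sum_(k < N.+1) dot (g k) (w k) + N.+1%:R * eps.
Proof.
move=> r0 r_mono r_ge0 c_ge0 gx gN w0 wS xbE.
have dotW k : forall j, (j <= N)%N -> dot (g k) (w j) =
    \sum_(i < j) (r i.+1 - r i) * (dot (g k) (x j) - dot (g k) (x i))
    + (dot (g k) (x j) - dot (g k) xs).
  apply: combination_recurrence => //; first by rewrite w0 !dotE.
  by move=> j jN; rewrite wS// !dotE.
have step k : (k < N)%N ->
    \sum_(i < k) (r i.+1 - r i) * ((f (x k) - f xs) - (f (x i) - f xs))
    + (f (x k) - f xs) <= dot (g k) (w k).
  move=> kN; rewrite dotW 1?ltnW//; apply: lerD.
    apply: ler_sum => i _; apply: ler_wpM2l.
      by rewrite subr_ge0 r_mono// (leq_ltn_trans _ kN).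
    have := gx k kN (x i); rewrite !dotE; lra.
  have := gx k kN xs; rewrite !dotE; lra.
have last_step :
    \sum_(i < N) pair_weight N r i * ((f xb - f xs) - (f (x i) - f xs))
    + (f xb - f xs) <= dot (g N) (w N) + N.+1%:R * eps.
  have -> := combination_last (A := fun i => dot (g N) (x i))
    (xb := dot (g N) xb) r0 (dotW N N (leqnn N)).
    have -> : N.+1%:R * eps = \sum_(i < N) pair_weight N r i * eps + eps.
      by rewrite -mulr_suml sum_pair_weight// -natr1 mulrDl mul1r.
    rewrite addrACA -big_split /=; apply: lerD.
      apply: ler_sum => i _; rewrite -mulrDr; apply: ler_wpM2l.
        by rewrite pair_weight_ge0 ?r_ge0 ?c_ge0.
      have := gN (x i); rewrite !dotE; lra.
    have := gN xs; rewrite !dotE; lra.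
  rewrite -dotZr xbE dotDr dotZr.
  rewrite (dot_sumr N (fun i => pair_weight N.+1 r i *: x i)).
  by congr (_ + _); apply: eq_bigr => i _; rewrite dotZr.
rewrite big_ord_recr /=.
have : \sum_(k < N)
    (\sum_(i < k) (r i.+1 - r i) * ((f (x k) - f xs) - (f (x i) - f xs))
    + (f (x k) - f xs)) <= \sum_(k < N) dot (g k) (w k).
  by apply: ler_sum => k _; exact: step.
rewrite (sum_pair_gaps N r (fun i => f (x i) - f xs) r0).
move: last_step.
rewrite (sum_pair_weight_gaps N r (fun i => f (x i) - f xs))// -natr1; lra.
Qed.

End GapBound.

(** * The functions u and xi *)

Section Rates.
Context {K : realType}.
Implicit Types (a s t x y : K) (m N : nat).

(** Concavity: the logarithm lies below its tangent at x. *)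
Lemma ln_sub_le x y : 0 < x -> 0 < y -> ln y - ln x <= (y - x) / x.
Proof.
move=> x0 y0; rewrite -ln_div ?posrE//.
have -> : y / x = 1 + (y - x) / x by field; lra.
by apply: le_ln1Dx; rewrite ltr_pdivlMr//; lra.
Qed.

(** Each increment of ln between a + k and a + k + 1 lies between the inverses of
    the two endpoints; the two bounds of the increments differ by a telescoping
    sum. This gives the present inequality and the next one. *)
Lemma gen_harmonic_le_ln m a : 0 < a ->
  gen_harmonic m (1 + a) <= ln (a + m%:R) - ln a.
Proof.
move=> a0; rewrite /gen_harmonic; elim: m => [|m IH].
  by rewrite big_ord0 addr0 subrr.
rewrite big_ord_recr /= -natr1.
have m0 : 0 <= m%:R :> K by [].
have am0 : 0 < a + m%:R by lra.
have am1 : 0 < a + (m%:R + 1) by lra.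
have := ln_sub_le _ _ am1 am0.
have -> : a + m%:R - (a + (m%:R + 1)) = - 1 by ring.
have -> : 1 + a + m%:R = a + (m%:R + 1) by ring.
rewrite mulN1r; lra.
Qed.

Lemma ln_le_gen_harmonic m a : 0 < a ->
  ln (a + m%:R) - ln a <= gen_harmonic m (1 + a) + (a^-1 - (a + m%:R)^-1).
Proof.
move=> a0; rewrite /gen_harmonic; elim: m => [|m IH].
  by rewrite big_ord0 addr0 !subrr addr0.
rewrite big_ord_recr /= -natr1.
have m0 : 0 <= m%:R :> K by [].
have am0 : 0 < a + m%:R by lra.
have am1 : 0 < a + (m%:R + 1) by lra.
have := ln_sub_le _ _ am0 am1.
have -> : a + (m%:R + 1) - (a + m%:R) = 1 by ring.
have -> : 1 + a + m%:R = a + (m%:R + 1) by ring.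
rewrite mul1r; lra.
Qed.

(** Intermediate values on [1, 1 + s]: as ln (1 + s) <= s, the right end has
    u^2 - 1 - 2 ln u >= s^2. *)
Lemma u_sol_spec s : 0 <= s ->
  1 <= u_sol s /\ s ^+ 2 = u_sol s ^+ 2 - 1 - 2 * ln (u_sol s).
Proof.
move=> s0.
suff : exists u, 1 <= u /\ s ^+ 2 = u ^+ 2 - 1 - 2 * ln u.
  exact: (@xgetPex _ 1 [set u | 1 <= u /\ s ^+ 2 = u ^+ 2 - 1 - 2 * ln u]).
pose F (u : K) := u ^+ 2 - 1 - 2 * ln u.
have s1 : 1 <= 1 + s by lra.
have [||u] := @IVT K F 1 (1 + s) (s ^+ 2) s1.
- apply: continuous_in_subspaceT => u; rewrite inE /= in_itv /= => /andP[u1 _].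
  have u0 : 0 < u by lra.
  have sq_cvg : v ^+ 2 @[v --> u] --> u ^+ 2 by exact: exprn_continuous.
  have ln_cvg : ln v @[v --> u] --> ln u by exact: continuous_ln.
  have h1 : v ^+ 2 - 1 @[v --> u] --> u ^+ 2 - 1.
    exact: (cvgB sq_cvg (cvg_cst _)).
  have h2 : 2 * ln v @[v --> u] --> 2 * ln u by exact: (cvgMl_tmp ln_cvg).
  exact: (cvgB h1 h2).
- have F1 : F 1 = 0 by rewrite /F ln1 expr1n; ring.
  have F2 : s ^+ 2 <= F (1 + s).
    have sN1 : -1 < s by lra.
    have := le_ln1Dx sN1; rewrite /F; lra.
  have s2 : 0 <= s ^+ 2 by rewrite exprn_ge0.
  by rewrite F1 ge_min le_max s2 F2 orbT.
- by rewrite in_itv /= => /andP[u1 _] uE; exists u; rewrite /= -uE.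
Qed.

Lemma u_sol0 : u_sol (0 : K) = 1.
Proof.
have [u1] := u_sol_spec 0 (lexx 0); set u := u_sol 0 in u1 *; rewrite expr0n /=.
have uN1 : -1 < u - 1 by lra.
have := le_ln1Dx uN1; rewrite subrKC; nra.
Qed.

Lemma u_sol_gt1 s : 0 < s -> 1 < u_sol s.
Proof.
move=> s0; have [u1 uE] := u_sol_spec s (ltW s0).
rewrite lt_neqAle u1 andbT; apply: contraTneq s0 => u_eq.
move: uE; rewrite -u_eq ln1 expr1n mulr0 !subr0 subrr => /eqP.
by rewrite expf_eq0 /= => /eqP ->; rewrite ltxx.
Qed.

Let harm N s := gen_harmonic N.+1 (1 + N.+1%:R / (u_sol s ^+ 2 - 1)).

(** With a = n / t, (a + n) / a = u^2, so that the logarithmic bounds on the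
    harmonic number compare it with 2 ln u, up to 1 / a - 1 / (a + n) <= t / n. *)
Lemma xi_denominator_bounds N s : 0 < s ->
  let t := u_sol s ^+ 2 - 1 in
  [/\ 0 < t, s ^+ 2 + 2 * ln (u_sol s) = t, 0 < s ^+ 2 + harm N s,
      s ^+ 2 + harm N s <= t & N%:R * t <= N.+1%:R * (s ^+ 2 + harm N s)].
Proof.
move=> s0 t; have u1 := u_sol_gt1 _ s0; have [_ uE] := u_sol_spec _ (ltW s0).
have t0 : 0 < t by rewrite /t; nra.
have n0 : 0 < N.+1%:R :> K by [].
set a := N.+1%:R / t; have a0 : 0 < a by rewrite divr_gt0.
have lnE : ln (a + N.+1%:R) - ln a = 2 * ln (u_sol s).
  rewrite -ln_div ?posrE ?addr_gt0//.
  have -> : (a + N.+1%:R) / a = u_sol s ^+ 2.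
    have -> : u_sol s ^+ 2 = 1 + t by rewrite /t; ring.
    rewrite /a; field; lra.
  by rewrite lnXn ?mulr_natl//; lra.
have h1 := gen_harmonic_le_ln N.+1 a a0; have h2 := ln_le_gen_harmonic N.+1 a a0.
rewrite lnE -/(harm N s) in h1 h2.
have h3 : 0 < harm N s.
  rewrite /harm -/t -/a /gen_harmonic big_ord_recl ltr_wpDr//.
    by apply: sumr_ge0 => k _; rewrite invr_ge0 addr_ge0//; lra.
  by rewrite invr_gt0 addr0; lra.
split => //; first by rewrite /t uE; ring.
- by rewrite addr_gt0 ?exprn_gt0.
- by rewrite /t; lra.
have aE : a^-1 = t / N.+1%:R by rewrite /a invf_div.
have b0 : 0 < (a + N.+1%:R)^-1 by rewrite invr_gt0 addr_gt0.
have tn : N.+1%:R * (t / N.+1%:R) = t by field; lra.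
have : N.+1%:R * (t - t / N.+1%:R) <= N.+1%:R * (s ^+ 2 + harm N s).
  rewrite ler_pM2l//; rewrite aE in h2; move: h2 b0.
  have -> : s ^+ 2 = t - 2 * ln (u_sol s) by rewrite uE /t.
  move: (t / _) (_ + _)^-1 (harm N s) (ln _) => q b H l; lra.
by rewrite mulrBr tn -{1}natr1; lra.
Qed.

Lemma xi_sq N s : 0 < s ->
  xi N s ^+ 2 * (s ^+ 2 + harm N s) = u_sol s ^+ 2 - 1.
Proof.
move=> s0; have [t0 tE d0 _ _] := xi_denominator_bounds N s s0.
rewrite /xi gt_eqF//= -/(harm N s) tE sqr_sqrtr ?divr_ge0// 1?ltW//.
by field; lra.
Qed.

Lemma xi_ge1 N s : 0 <= s -> 1 <= xi N s.
Proof.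
rewrite le_eqVlt => /predU1P[<-|s0]; first by rewrite /xi eqxx.
have [t0 tE d0 dt _] := xi_denominator_bounds N s s0.
rewrite /xi gt_eqF//= -/(harm N s) tE -[X in X <= _]sqrtr1 ler_wsqrtr//.
by rewrite ler_pdivlMr// mul1r.
Qed.

(** In fact xi^2 <= 1 + 1 / N, by the last bound of [xi_denominator_bounds]. *)
Lemma xi_le N s : (0 < N)%N -> 0 <= s -> xi N s <= 1 + 2 / N%:R.
Proof.
move=> N0; have n0 : 0 < N%:R :> K by rewrite ltr0n.
have v0 : 0 < N%:R^-1 :> K by rewrite invr_gt0.
rewrite le_eqVlt => /predU1P[<-|s0]; first by rewrite /xi eqxx; lra.
have [t0 tE d0 _ dt] := xi_denominator_bounds N s s0.
rewrite /xi gt_eqF//= -/(harm N s) tE.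
have p0 : 0 <= 1 + 2 / N%:R :> K by lra.
rewrite -[leRHS]ger0_norm// -sqrtr_sqr ler_wsqrtr//.
have d_le : (u_sol s ^+ 2 - 1) / (s ^+ 2 + harm N s) <= 1 + N%:R^-1.
  rewrite ler_pdivrMr// -(ler_pM2l n0).
  have -> : N%:R * ((1 + N%:R^-1) * (s ^+ 2 + harm N s)) =
            N.+1%:R * (s ^+ 2 + harm N s) by rewrite -natr1; field; lra.
  exact: dt.
apply: (le_trans d_le); nra.
Qed.

End Rates.

(** * Ratios of tail sums of a schedule *)

Section ScheduleRatios.
Context {K : realType}.
Implicit Types (N : nat) (h : nat -> \bar K) (alpha : nat -> K).

(** The index is shifted by one with respect to [tail_ratio]: the term k is
    (h_k + ... + h_N) / (h_0 + ... + h_N), and the term 0 is the full ratio 1. It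
    lets finite and infinite last steps be treated together. *)
Definition step_ratio N h (k : nat) : K :=
  if k is k'.+1 then tail_ratio N h k' else 1.

Lemma step_ratio_infinite N h k : h N = +oo%E -> step_ratio N h k = 1.
Proof. by move=> hN; case: k => //= k; rewrite /tail_ratio hN eqxx. Qed.

Lemma step_ratio_finite {N h} : is_schedule N h -> h N != +oo%E ->
  let T k := \sum_(k <= i < N.+1) fine (h i) in
  [/\ forall k, (k <= N)%N -> 0 <= fine (h k),
      0 < T 0%N,
      forall k, step_ratio N h k = T k / T 0%N &
      forall k, tail_mean N h k = ((N - k)%:R^-1 * T k.+1)%:E].
Proof.
move=> [h_lt hN0 h_gt0] hNoo T.
have h_fin k : (k < N.+1)%N -> h k = (fine (h k))%:E.
  rewrite ltnS leq_eqVlt => /predU1P[->|kN]; rewrite fineK// ge0_fin_numE.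
  - by rewrite lt_neqAle hNoo leey.
  - by [].
  - by have /andP[] := h_lt k kN.
  - by have /andP[] := h_lt k kN.
have TE k : \sum_(k <= i < N.+1) h i = (T k)%:E.
  by rewrite /T -sumEFin; apply: eq_big_nat => i /andP[_ iN]; exact: h_fin.
have T0 : 0 < T 0%N by rewrite -lte_fin -TE.
split => //.
- move=> k; rewrite leq_eqVlt => /predU1P[->|kN]; first exact: fine_ge0.
  by apply: fine_ge0; have /andP[] := h_lt k kN.
- case=> [|k] /=; first by rewrite divff// gt_eqF.
  by rewrite /tail_ratio (negbTE hNoo) !TE.
- by move=> k; rewrite /tail_mean TE.
Qed.

Lemma step_ratio_ge0 N h k : is_schedule N h -> 0 <= step_ratio N h k.
Proof.
move=> sch; have [hN|hN] := eqVneq (h N) +oo%E.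
  by rewrite step_ratio_infinite.
have [h0 T0 -> _] := step_ratio_finite sch hN.
apply: divr_ge0; last exact: ltW.
rewrite big_nat_cond; apply: sumr_ge0 => i.
by rewrite andbT => /andP[_ iN]; exact: h0.
Qed.

Lemma step_ratio_nonincreasing N h k : is_schedule N h -> (k <= N)%N ->
  0 <= step_ratio N h k - step_ratio N h k.+1.
Proof.
move=> sch kN; have [hN|hN] := eqVneq (h N) +oo%E.
  by rewrite !step_ratio_infinite// subrr.
have [h0 T0 E _] := step_ratio_finite sch hN.
by rewrite !E -mulrBl big_ltn// addrK divr_ge0 ?h0// ltW.
Qed.

Lemma step_ratio_mean_nondecreasing N h k l : admissible N h ->
  (k <= l < N)%N ->
  step_ratio N h k.+1 / (N%:R - k%:R) <= step_ratio N h l.+1 / (N%:R - l%:R).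
Proof.
move=> [sch mean_mono] klN; have /andP[kl lN] := klN.
have kN : (k < N)%N := leq_ltn_trans kl lN.
rewrite -(natrB K (ltnW kN)) -(natrB K (ltnW lN)).
have [hN|hN] := eqVneq (h N) +oo%E.
  rewrite !step_ratio_infinite// !div1r lef_pV2 ?posrE ?ltr0n ?subn_gt0//.
  by rewrite ler_nat leq_sub2l.
have [_ T0 E M] := step_ratio_finite sch hN.
have := mean_mono k l klN; rewrite !M lee_fin !E.
by rewrite -!(mulrAC _ _%:R^-1) ler_pM2r ?invr_gt0// -!(mulrC _%:R^-1).
Qed.

Lemma final_pointE {X : completeNormedModType K} N h (x : nat -> X) :
    is_schedule N h ->
  final_point N h x =
  \sum_(i < N) (step_ratio N h i - step_ratio N h i.+1) *: x i
  + step_ratio N h N *: x N.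
Proof.
move=> sch; rewrite /final_point; have [hN|hN] := eqVneq (h N) +oo%E.
  rewrite step_ratio_infinite// scale1r big1 ?add0r// => i _.
  by rewrite !step_ratio_infinite// subrr scale0r.
have [_ T0 E _] := step_ratio_finite sch hN.
rewrite scaler_sumr big_mkord big_ord_recr; congr (_ + _).
  apply: eq_bigr => i _; rewrite !E -mulrBl [in RHS]big_ltn ?ltnS 1?ltnW//.
  by rewrite addrK scalerA mulrC.
by rewrite E big_nat1 scalerA mulrC.
Qed.

(** Admissibility compares tail means from k = 0 on, and does not say that the
    mean of h_1, ..., h_N is at least that of h_0, ..., h_N. This follows from the
    prescribed products. Let H be the total, H y1 and H y2 the tails from 1 and 2:
    then alpha_0 = H (1 - y1) y1 and alpha_1 = H (y1 - y2) y2, and since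
    y2 / (N - 1) >= y1 / N, the second is at most H y1^2 (N - 1) / N^2. With
    alpha_0 / N <= alpha_1 / (N - 1) this gives N (1 - y1) <= y1. *)
Lemma first_step_ratio_ge N h alpha : admissible_for N alpha h ->
    (1 < N)%N -> 0 < alpha 0%N -> alpha 0%N * (N%:R - 1) <= alpha 1%N * N%:R ->
  N%:R <= N.+1%:R * step_ratio N h 1.
Proof.
move=> [adm hE] N1 a0 a01; have sch := adm.1.
have [hN|hN] := eqVneq (h N) +oo%E.
  by rewrite step_ratio_infinite// mulr1 ler_nat.
have [_ T0 E _] := step_ratio_finite sch hN.
have := step_ratio_mean_nondecreasing N h 0 1 adm (introT andP (conj isT N1)).
have hk k : (k < N.+1)%N -> fine (h k) =
    (\sum_(0 <= i < N.+1) fine (h i)) * (step_ratio N h k - step_ratio N h k.+1).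
  by move=> kN; rewrite !E -mulrBl mulrC divfK ?gt_eqF// big_ltn// addrK.
have y1 := step_ratio_ge0 N h 1 sch.
have hE0 := hE 0%N (ltnW N1); have hE1 := hE 1%N N1.
rewrite -[tail_ratio _ _ _]/(step_ratio N h 1) in hE0.
rewrite -[tail_ratio _ _ _]/(step_ratio N h 2) in hE1.
move: hE0 hE1 a0 a01; rewrite !hk//; last exact: ltnW.
move=> <- <-; rewrite -[step_ratio N h 0]/(1 : K).
set H := \sum_(0 <= _ < _) _ in T0 *.
move: (step_ratio N h 1) (step_ratio N h 2) y1 => y1 y2 y1_ge0 a0 a01.
have n1 : 1 < N%:R :> K by rewrite ltr1n.
rewrite subr0 ler_pdivrMr; last by lra.
rewrite mulrAC ler_pdivlMr; last by lra.
rewrite -natr1 => y12.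
have y1_gt0 : 0 < y1.
  by rewrite lt_def y1_ge0 andbT; apply: contraTneq a0 => ->; rewrite mulr0 ltxx.
have {}a01 : (1 - y1) * y1 * (N%:R - 1) <= (y1 - y2) * y2 * N%:R.
  by rewrite -(ler_pM2l T0) -/H !mulrA.
have n2 : 2 <= N%:R :> K by rewrite ler_nat.
(* This is N^2 (y1 - y2) y2 <= (N - 1) y1^2: beyond y1 / 2 the left-hand side
   decreases in y2, and y2 >= (N - 1) y1 / N. *)
have prod_ge0 : 0 <= (N%:R * y2 - (N%:R - 1) * y1) * (N%:R * y2 - y1).
  have y1_le : y1 <= (N%:R - 1) * y1 by rewrite ler_peMl//; lra.
  by rewrite mulr_ge0//; lra.
rewrite -subr_ge0 -(pmulr_rge0 _ y1_gt0).
rewrite -(pmulr_rge0 _ (_ : 0 < N%:R - 1)); last by lra.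
have : N%:R * ((1 - y1) * y1 * (N%:R - 1)) <= N%:R * ((y1 - y2) * y2 * N%:R).
  by rewrite ler_pM2l//; lra.
lra.
Qed.

End ScheduleRatios.

(** * The prescribed effective steps *)

Section StepProfile.
Context {K : realType}.
Implicit Types (N k : nat) (L R s : K).

(** The step n alpha'_k / (N - k) of the auxiliary sequence, defined at k = N too,
    where it weights the subgradient at the output point. *)
Definition effective_step N L R s (k : nat) : K :=
  R / L * (xi N s / Num.sqrt N.+1%:R)
  * (u_sol s / (u_sol s ^+ 2 - (u_sol s ^+ 2 - 1) * (k%:R / N.+1%:R))).

Lemma alpha'E N L R s k : (k <= N)%N ->
  alpha' N L R s k = effective_step N L R s k * (N%:R - k%:R) / N.+1%:R.
Proof.
move=> kN; rewrite /alpha' /effective_step natrB//.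
have n0 : 0 < N.+1%:R :> K by [].
have -> : N.+1%:R `^ (3 / 2) = N.+1%:R * Num.sqrt N.+1%:R :> K.
  have -> : 3 / 2 = 1 + 2^-1 :> K by field.
  by rewrite powRD ?powRr1 ?powR12_sqrt// gt_eqF//; apply/implyP.
rewrite invfM; ring.
Qed.

Lemma effective_step_denominator_gt0 N s k : 0 <= s -> (k <= N)%N ->
  0 < u_sol s ^+ 2 - (u_sol s ^+ 2 - 1) * (k%:R / N.+1%:R).
Proof.
move=> s0 kN; have [u1 _] := u_sol_spec _ s0.
have n0 : 0 < N.+1%:R :> K by [].
have q1 : k%:R / N.+1%:R <= 1 :> K by rewrite ler_pdivrMr// mul1r ler_nat ltnW.
have : 0 <= (u_sol s ^+ 2 - 1) * (1 - k%:R / N.+1%:R).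
  by rewrite mulr_ge0 ?subr_ge0// expr_ge1//; lra.
move: (k%:R / _) => q; lra.
Qed.

Lemma effective_step_gt0 N L R s k : 0 < L -> 0 < R -> 0 <= s -> (k <= N)%N ->
  0 < effective_step N L R s k.
Proof.
move=> L0 R0 s0 kN; have [u1 _] := u_sol_spec _ s0.
have n0 : 0 < Num.sqrt N.+1%:R :> K by rewrite sqrtr_gt0.
have D0 := effective_step_denominator_gt0 _ _ _ s0 kN; have x1 := xi_ge1 N _ s0.
have x0 : 0 < xi N s by lra.
have u0 : 0 < u_sol s by lra.
by rewrite /effective_step (mulr_gt0 (mulr_gt0 _ _)) ?divr_gt0.
Qed.

(** The inverse of the step is affine in k with slope - d: writing the step as
    c u / D, the next one is c u / (D - q) with q = t / n = c u d, and
    1 / D + q / D^2 <= 1 / (D - q) amounts to D^2 - q^2 <= D^2. *)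
Lemma effective_step_growth N L R s k : 0 < L -> 0 < R -> 0 <= s ->
    (k < N)%N ->
  let d := L / R * ((u_sol s ^+ 2 - 1)
                    / (u_sol s * Num.sqrt N.+1%:R * xi N s)) in
  effective_step N L R s k + d * effective_step N L R s k ^+ 2 <=
  effective_step N L R s k.+1.
Proof.
move=> L0 R0 s0 kN /=; have [u1 _] := u_sol_spec _ s0.
have n0 : 0 < N.+1%:R :> K by [].
have r0 : 0 < Num.sqrt N.+1%:R :> K by rewrite sqrtr_gt0.
have rE : Num.sqrt N.+1%:R ^+ 2 = N.+1%:R :> K by rewrite sqr_sqrtr.
have D0 := effective_step_denominator_gt0 _ _ _ s0 (ltnW kN).
have D'0 := effective_step_denominator_gt0 _ _ _ s0 kN.
have x1 := xi_ge1 N _ s0; rewrite /effective_step.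
set t := u_sol s ^+ 2 - 1 in D0 D'0 *.
have DE : u_sol s ^+ 2 - t * (k.+1%:R / N.+1%:R) =
    u_sol s ^+ 2 - t * (k%:R / N.+1%:R) - t / N.+1%:R by rewrite -natr1; ring.
rewrite DE in D'0 *; set D := _ - t * _ in D0 D'0 *.
set c := R / L * (xi N s / Num.sqrt N.+1%:R).
have x0 : 0 < xi N s by lra.
have u0 : 0 < u_sol s by lra.
have c0 : 0 < c by rewrite /c mulr_gt0 ?divr_gt0.
have -> : L / R * (t / (u_sol s * Num.sqrt N.+1%:R * xi N s)) =
    t / N.+1%:R / (c * u_sol s).
  rewrite /c; move: rE r0; set rt := Num.sqrt _ => <- r0; field.
  by rewrite !gt_eqF//; lra.
move: D0 D'0; move: (t / N.+1%:R) => q D0 D'0.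
have -> : c * (u_sol s / D) + q / (c * u_sol s) * (c * (u_sol s / D)) ^+ 2 =
    c * u_sol s * ((D + q) / D ^+ 2).
  by field; rewrite !gt_eqF//; lra.
rewrite (mulrA c) (ler_pM2l (mulr_gt0 c0 u0)).
rewrite ler_pdivrMr ?exprn_gt0// mulrC ler_pdivlMr//.
have : 0 <= q ^+ 2 by rewrite sqr_ge0.
lra.
Qed.

(** Term by term after reversing the order, since u^2 = 1 + t. *)
Lemma sum_effective_step N L R s : 0 < s ->
  \sum_(k < N.+1) effective_step N L R s k =
  R / L * xi N s * Num.sqrt N.+1%:R * u_sol s / (u_sol s ^+ 2 - 1)
  * gen_harmonic N.+1 (1 + N.+1%:R / (u_sol s ^+ 2 - 1)).
Proof.
move=> s0; have [t0 _ _ _ _] := xi_denominator_bounds N _ s0.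
have n0 : 0 < N.+1%:R :> K by [].
have r0 : 0 < Num.sqrt N.+1%:R :> K by rewrite sqrtr_gt0.
have rE : Num.sqrt N.+1%:R ^+ 2 = N.+1%:R :> K by rewrite sqr_sqrtr.
rewrite /gen_harmonic (reindex_inj rev_ord_inj) mulr_sumr; apply: eq_bigr => k _.
have D0 := effective_step_denominator_gt0 _ _ _ (ltW s0) (leq_ord (rev_ord k)).
move: D0; rewrite /effective_step /= subSS (natrB K (leq_ord k)) => D0.
set t := u_sol s ^+ 2 - 1 in t0 D0 *; set D := u_sol s ^+ 2 - _ in D0 *.
have -> : 1 + N.+1%:R / t + k%:R = N.+1%:R / t * D.
  rewrite /D; have -> : u_sol s ^+ 2 = 1 + t by rewrite /t; ring.
  rewrite -natr1 in n0 *; field; lra.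
move: rE r0; set rt := Num.sqrt _ => <- r0.
by move: (R / L) => q; field; rewrite !gt_eqF.
Qed.

(** With Z = R L sqrt n u, the three terms are Z / xi, Z xi H / t and
    Z xi s^2 / t; the last two add up to Z / xi because xi^2 (s^2 + H) = t. *)
Lemma certificate_value N L R s : 0 < L -> 0 < R -> 0 < s ->
  let b := R / L * (u_sol s * Num.sqrt N.+1%:R * xi N s / (u_sol s ^+ 2 - 1)) in
  R ^+ 2 / effective_step N L R s 0
  + L ^+ 2 * (\sum_(k < N.+1) effective_step N L R s k) + b * (L * s) ^+ 2 <=
  2 * (R * L * Num.sqrt N.+1%:R * u_sol s).
Proof.
move=> L0 R0 s0 /=; have [u1 _] := u_sol_spec _ (ltW s0).
have [t0 _ d0 _ _] := xi_denominator_bounds N _ s0.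
have n0 : 0 < N.+1%:R :> K by [].
have r0 : 0 < Num.sqrt N.+1%:R :> K by rewrite sqrtr_gt0.
have x1 := xi_ge1 N _ (ltW s0); have xE := xi_sq N _ s0.
rewrite sum_effective_step// /effective_step mul0r mulr0 subr0.
move: xE t0 d0; set t := _ - 1; set H := gen_harmonic _ _ => xE t0 d0.
set Z := R * L * Num.sqrt N.+1%:R * u_sol s.
have Z0 : 0 < Z by rewrite /Z !mulr_gt0//; lra.
have -> : R ^+ 2 / (R / L * (xi N s / Num.sqrt N.+1%:R)
    * (u_sol s / u_sol s ^+ 2)) = Z / xi N s.
  by rewrite /Z; field; rewrite !gt_eqF//; lra.
have E : xi N s * (s ^+ 2 + H) / t = (xi N s)^-1.
  by rewrite -xE; field; rewrite !gt_eqF//; lra.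
have -> : L ^+ 2 * (R / L * xi N s * Num.sqrt N.+1%:R * u_sol s / t * H)
    = Z * (xi N s * H / t).
  by rewrite /Z; field; rewrite !gt_eqF//; lra.
have -> : R / L * (u_sol s * Num.sqrt N.+1%:R * xi N s / t) * (L * s) ^+ 2 =
    Z * (xi N s * s ^+ 2 / t).
  by rewrite /Z; field; rewrite !gt_eqF//; lra.
have -> : Z / xi N s + Z * (xi N s * H / t) + Z * (xi N s * s ^+ 2 / t) =
    Z * ((xi N s)^-1 + xi N s * (s ^+ 2 + H) / t) by ring.
rewrite E [leRHS]mulrC ler_pM2l//.
have : (xi N s)^-1 <= 1 by rewrite invf_le1//; lra.
lra.
Qed.

(** At s = 0 all steps equal R / (L sqrt n), and there is no error term. *)
Lemma certificate_value0 N L R : 0 < L -> 0 < R ->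
  R ^+ 2 / effective_step N L R 0 0
  + L ^+ 2 * (\sum_(k < N.+1) effective_step N L R 0 k) =
  2 * (R * L * Num.sqrt N.+1%:R).
Proof.
move=> L0 R0; have n0 : 0 < N.+1%:R :> K by [].
have r0 : 0 < Num.sqrt N.+1%:R :> K by rewrite sqrtr_gt0.
have rE : Num.sqrt N.+1%:R ^+ 2 = N.+1%:R :> K by rewrite sqr_sqrtr.
have E k : effective_step N L R 0 k = R / (L * Num.sqrt N.+1%:R).
  rewrite /effective_step u_sol0 /xi eqxx expr1n subrr mul0r subr0.
  by field; rewrite !gt_eqF.
rewrite E; under eq_bigr do rewrite E.
rewrite sumr_const card_ord -(mulr_natr (R / _)).
move: rE r0; set rt := Num.sqrt _ => <- r0.
by field; rewrite !gt_eqF.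
Qed.

End StepProfile.

(** * The convergence rate *)

Section MainEstimate.
Context {K : realType} {X : completeNormedModType K}.
Context {dot : {dot X for idfun}}.
Hypothesis dot_norm : forall v : X, dot v v = `|v| ^+ 2.

Lemma dot_young (b d : K) (u v : X) : 0 < b -> b * d = 1 ->
  - 2 * dot u v <= b * `|u| ^+ 2 + d * `|v| ^+ 2.
Proof.
move=> b0 bd; rewrite -(ler_pM2l b0).
have : 0 <= `|b *: u + v| ^+ 2 by rewrite exprn_ge0.
rewrite -!dot_norm !dotE (dotC v u) !mulrDr (mulrA b d) bd; lra.
Qed.

(** The two estimates are put together for any effective steps beta that grow fast
    enough; the rate is then a matter of evaluating the right-hand side. *)
Lemma final_gap_bound {N : nat} {h : nat -> \bar K} {alpha beta : nat -> K}
    {L R b d : K} {f : X -> K} {x0 xs : X} {x g e : nat -> X} :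
    (0 < N)%N -> 0 < L -> admissible_for N alpha h ->
    (forall k, (k <= N)%N -> 0 < beta k) ->
    (forall k, (k < N)%N -> beta k <= beta k.+1) ->
    (forall k, (k < N)%N -> beta k + d * beta k ^+ 2 <= beta k.+1) ->
    (forall k, (k < N)%N -> alpha k = beta k * (N%:R - k%:R) / N.+1%:R) ->
    (forall k v, (k < N)%N ->
       - 2 * dot (e k) v <= b * `|e k| ^+ 2 + d * `|v| ^+ 2) ->
    convex_function setT f -> continuous f ->
    (forall y v, subdifferential dot f y v -> `|v| <= L) ->
    is_minimizer f xs -> `|xs - x0| <= R ->
    subgradient_method dot N h f x0 x g e ->
  2 * (N.+1%:R * (f (x N.+1) - f xs)) <=
  R ^+ 2 / beta 0%N + L ^+ 2 * \sum_(k < N.+1) beta k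
  + b * \sum_(k < N) `|e k| ^+ 2.
Proof.
move=> N0 L0 adm beta0 beta_mono betaS alphaE young cvxf cf fL xs_min xsR.
move=> [x0E gx xS xNE]; have sch := adm.1.1.
have n0 : 0 < N.+1%:R :> K by [].
pose r k := N.+1%:R * step_ratio N h k / (N.+1%:R - k%:R).
have den_gt0 k : (k <= N)%N -> 0 < N.+1%:R - k%:R :> K.
  by move=> kN; rewrite subr_gt0 ltr_nat ltnS.
have r0 : r 0%N = 1 by rewrite /r mulr1 subr0 divff// gt_eqF.
have r_ge0 k : (k < N)%N -> 0 <= r k.+1.
  move=> kN; rewrite divr_ge0 ?(ltW (den_gt0 _ _))//.
  by rewrite mulr_ge0// ?step_ratio_ge0// ltW.
have rS k : r k.+1 = N.+1%:R * (step_ratio N h k.+1 / (N%:R - k%:R)).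
  by rewrite /r mulrA -!natr1; congr (_ / _); ring.
have r_mono k : (k.+1 < N)%N -> r k <= r k.+1.
  (* The first increment compares r_1 with r_0 = 1, the others are tail means. *)
  case: k => [N1|k kN].
    rewrite r0 rS subr0 mulrA ler_pdivlMr ?ltr0n// mul1r.
    apply: (first_step_ratio_ge _ _ _ adm N1).
      rewrite alphaE// subr0 divr_gt0// mulr_gt0 ?ltr0n//.
      exact: beta0.
    rewrite !alphaE// subr0.
    set c : K := N%:R * (N%:R - 1) / N.+1%:R.
    rewrite [leLHS](_ : _ = beta 0%N * c); last by rewrite /c; ring.
    rewrite [leRHS](_ : _ = beta 1%N * c); last by rewrite /c; ring.
    by rewrite ler_pM2r ?beta_mono// divr_gt0// mulr_gt0 ?ltr0n ?subr_gt0 ?ltr1n.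
  rewrite !rS ler_pM2l//; apply: step_ratio_mean_nondecreasing adm.1 _.
  by rewrite leqnSn ltnW.
have rE k : (k <= N)%N -> (N.+1%:R - k%:R) * r k = N.+1%:R * step_ratio N h k.
  by move=> kN; rewrite /r mulrC divfK// gt_eqF// den_gt0.
have weightE k : (k < N)%N -> pair_weight N.+1 r k =
    N.+1%:R * (step_ratio N h k - step_ratio N h k.+1).
  move=> kN; rewrite mulrBr -(rE k (ltnW kN)) -(rE k.+1 kN) /pair_weight.
  ring.
have stepE k : (k < N)%N -> r k.+1 *: (x k.+1 - x k) = - (beta k *: (g k + e k)).
  move=> kN; rewrite xS// addrAC subrr add0r scalerN scalerA; congr (- (_ *: _)).
  have Nk : 0 < N%:R - k%:R :> K by rewrite subr_gt0 ltr_nat.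
  rewrite rS; have := adm.2 k kN; rewrite alphaE// -/(step_ratio N h k.+1) => E.
  rewrite (_ : _ * fine (h k) =
    N.+1%:R / (N%:R - k%:R) * (fine (h k) * step_ratio N h k.+1)); last by ring.
  rewrite E; move: (N.+1%:R) n0 (N%:R - k%:R) Nk => n n_gt0 m m0.
  by field; rewrite !gt_eqF.
pose w k := x0 - xs + \sum_(i < k) r i.+1 *: (x i.+1 - x i).
have wS k : w k.+1 = w k + r k.+1 *: (x k.+1 - x k).
  by rewrite /w big_ord_recr /= addrA.
have xbE : N.+1%:R *: x N.+1 =
    \sum_(i < N) pair_weight N.+1 r i *: x i + r N *: x N.
  rewrite xNE final_pointE// scalerDr scaler_sumr; congr (_ + _).
    by apply: eq_bigr => i _; rewrite weightE// scalerA.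
  by rewrite scalerA -rE// -[N.+1%:R]natr1 addrAC subrr add0r mul1r.
have w0R : `|w 0%N| <= R by rewrite /w big_ord0 addr0 distrC.
apply/ler_addgt0Pr => eps eps0.
(* The error of the approximate subgradient enters with weight 2 (N + 1). *)
have eps'0 : 0 < eps / (2 * N.+1%:R) by rewrite divr_gt0// mulr_gt0.
have [v vL v_sub] :=
  approx_subgradient dot_norm (x N.+1) cvxf cf xs_min L0 fL eps'0.
pose G k := if (k < N)%N then g k else v.
have G_sub k : (k < N)%N -> subdifferential dot f (x k) (G k).
  by move=> kN; rewrite /G kN; exact: gx.
have GN : G N = v by rewrite /G ltnn.
have GL k : (k <= N)%N -> `|G k| <= L.
  by move=> _; rewrite /G; case: ifPn => // kN; apply: (fL (x k)); exact: gx.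
rewrite -GN in v_sub.
have c_ge0 k : (k < N)%N -> 0 <= pair_weight N.+1 r k.
  by move=> kN; rewrite weightE// mulr_ge0 ?step_ratio_nonincreasing// ltnW.
have w0E : w 0%N = x 0%N - xs by rewrite /w big_ord0 addr0 x0E.
have gap := gap_le_regret r0 r_mono r_ge0 c_ge0 G_sub v_sub w0E
  (fun k _ => wS k) xbE.
have w_step k : (k < N)%N -> w k.+1 = w k - beta k *: (G k + e k).
  by move=> kN; rewrite wS stepE// /G kN.
have := regret_bound_radius dot_norm GL w_step beta0 betaS young w0R.
have : 2 * (N.+1%:R * (eps / (2 * N.+1%:R))) = eps.
  by field; rewrite gt_eqF.
move: gap; move: (eps / _) (\sum_(k < N.+1) dot _ _) (R ^+ 2 / _) => q D Q.
move: (\sum_(k < N) _) (\sum_(k < N.+1) _) => E B; lra.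
Qed.

End MainEstimate.

Theorem lemma2 (K : realType) (X : completeNormedModType K)
    (dot : {dot X for idfun}) (dot_norm : forall v : X, dot v v = `|v| ^+ 2)
    (x0 : X) (N : nat) (L R gamma : K)
    (N_ge1 : (1 <= N)%N) (L_gt0 : 0 < L) (R_gt0 : 0 < R) (gamma_ge0 : 0 <= gamma) :
  (let sigma := gamma / L in
   forall h : nat -> \bar K, admissible_for N (alpha' N L R sigma) h ->
   forall (f : X -> K) (xstar : X),
     convex_class dot L R x0 f -> is_minimizer f xstar ->
   forall x g e : nat -> X,
     subgradient_method dot N h f x0 x g e ->
     \sum_(0 <= k < N) `|e k| ^+ 2 <= gamma ^+ 2 ->
     f (x N.+1) - f xstar <= R * L / Num.sqrt N.+1%:R * u_sol sigma)
  /\ (forall sigma : K, 0 <= sigma <= Num.sqrt N%:R ->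
        1 <= xi N sigma <= 1 + 2 / N%:R).
Proof.
split; last by move=> s /andP[s0 _]; rewrite xi_ge1//= xi_le.
move=> s h adm f xstar [cvxf cf fL [xs [xs_min xsR]]] xstar_min x g e meth.
rewrite big_mkord => e_le.
have -> : f xstar = f xs by apply/le_anti; rewrite xstar_min xs_min.
have s0 : 0 <= s by rewrite divr_ge0// ltW.
have n0 : 0 < N.+1%:R :> K by [].
have r0 : 0 < Num.sqrt N.+1%:R :> K by rewrite sqrtr_gt0.
have rE : Num.sqrt N.+1%:R ^+ 2 = N.+1%:R :> K by rewrite sqr_sqrtr.
suff gap_le : 2 * (N.+1%:R * (f (x N.+1) - f xs)) <=
    2 * (R * L * Num.sqrt N.+1%:R * u_sol s).
  move: gap_le; rewrite ler_pM2l// -ler_pdivlMl// => /le_trans; apply.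
  rewrite le_eqVlt; apply/predU1P; left.
  by move: rE r0; set rt := Num.sqrt _ => <- r0; field; rewrite !gt_eqF.
have beta0 k : (k <= N)%N -> 0 < effective_step N L R s k.
  exact: effective_step_gt0.
pose d := L / R * ((u_sol s ^+ 2 - 1) / (u_sol s * Num.sqrt N.+1%:R * xi N s)).
have betaS k : (k < N)%N -> effective_step N L R s k
    + d * effective_step N L R s k ^+ 2 <= effective_step N L R s k.+1.
  exact: effective_step_growth.
have u1 : 1 <= u_sol s := (u_sol_spec s s0).1.
have x1 : 1 <= xi N s := xi_ge1 N s s0.
have t0 : 0 <= u_sol s ^+ 2 - 1 by rewrite subr_ge0 expr_ge1//; lra.
have d0 : 0 <= d.
  apply: mulr_ge0; first exact/ltW/divr_gt0.
  by apply/divr_ge0/mulr_ge0 => //; [apply: mulr_ge0; [lra | exact: ltW] | lra].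
have beta_mono k : (k < N)%N ->
    effective_step N L R s k <= effective_step N L R s k.+1.
  move=> kN; apply: le_trans (betaS k kN).
  by rewrite lerDl mulr_ge0// exprn_ge0// ltW// beta0// ltnW.
have alphaE k (kN : (k < N)%N) := alpha'E N L R s k (ltnW kN).
(* At s = 0 the steps are constant and d = 0, so no b satisfies b d = 1; but then
   there are no errors to pay for, and b = 0 will do. *)
move: (s0); rewrite le_eqVlt => /predU1P[s_eq0|s_gt0].
  have gamma0 : gamma = 0.
    by apply: (mulIf (invr_neq0 (lt0r_neq0 L_gt0))); rewrite mul0r.
  have e0 k : (k < N)%N -> e k = 0.
    move=> kN; move: e_le; rewrite gamma0 expr0n /= => sum_le0.
    have sum0 : \sum_(k < N) `|e k| ^+ 2 = 0.
      by apply/le_anti; rewrite sum_le0 sumr_ge0// => i _; rewrite exprn_ge0.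
    have := psumr_eq0P (fun (i : 'I_N) _ => exprn_ge0 2 (normr_ge0 (e i))) sum0.
    by move=> /(_ (Ordinal kN) isT)/eqP; rewrite expf_eq0 /= normr_eq0 => /eqP.
  have young k v : (k < N)%N ->
      - 2 * dot (e k) v <= 0 * `|e k| ^+ 2 + d * `|v| ^+ 2.
    move=> kN; rewrite e0// linear0l mulr0 mul0r add0r.
    by rewrite mulr_ge0 ?exprn_ge0.
  have := final_gap_bound dot_norm N_ge1 L_gt0 adm beta0 beta_mono betaS alphaE
    young cvxf cf fL xs_min xsR meth.
  by rewrite mul0r addr0 -s_eq0 certificate_value0// u_sol0 mulr1.
have [t_gt0 _ _ _ _] := xi_denominator_bounds N s s_gt0.
have u0 : 0 < u_sol s by lra.
have xi0 : 0 < xi N s by lra.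
pose b := R / L * (u_sol s * Num.sqrt N.+1%:R * xi N s / (u_sol s ^+ 2 - 1)).
have b0 : 0 < b by rewrite mulr_gt0 ?divr_gt0 ?mulr_gt0.
have bd : b * d = 1.
  rewrite /b /d; move: (u_sol s ^+ 2 - 1) t_gt0 => t t_gt0.
  by field; rewrite !gt_eqF.
have young k v (_ : (k < N)%N) := dot_young dot_norm b d (e k) v b0 bd.
have gap := final_gap_bound dot_norm N_ge1 L_gt0 adm beta0 beta_mono betaS
  alphaE young cvxf cf fL xs_min xsR meth.
apply: (le_trans gap).
apply: le_trans (certificate_value N L R s L_gt0 R_gt0 s_gt0).
rewrite lerD2l ler_pM2l// /s mulrC divfK ?gt_eqF//.
Qed.
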